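(* Let $K$ be the Kenkatabami graph. The two-dimensional homshift $X^2_K$ does not have the box-extension property.
   Context: The Kenkatabami graph $K$ is the undirected graph without self-loops with 16 vertices $\omega,\mu_1,\dots,\mu_6,\gamma_1,\gamma_2,\gamma_3,\delta_1,\delta_2,\delta_3,\epsilon_1,\epsilon_2,\epsilon_3$ and the following 27 edges: $\omega\mu_1,\omega\mu_2,\omega\mu_3,\omega\mu_4,\omega\mu_5,\omega\mu_6$; $\gamma_1\mu_2,\gamma_1\mu_3,\gamma_2\mu_4,\gamma_2\mu_5,\gamma_3\mu_1,\gamma_3\mu_6$; $\delta_1\mu_1,\delta_1\mu_2,\delta_2\mu_3,\delta_2\mu_4,\delta_3\mu_5,\delta_3\mu_6$; $\epsilon_1\delta_1,\epsilon_2\delta_2,\epsilon_3\delta_3$; $\epsilon_1\gamma_1,\epsilon_1\gamma_3,\epsilon_2\gamma_1,\epsilon_2\gamma_2,\epsilon_3\gamma_2,\epsilon_3\gamma_3$. For a finite undirected graph $G$ with vertex set $V_G$ and (symmetric) edge set $E_G$, $X^2_G$ is the set of $x\in V_G^{\mathbb{Z}^2}$ with $(x_{\mathbf i},x_{\mathbf j})\in E_G$ whenever $|\mathbf i-\mathbf j|_1=1$. A locally admissible pattern on a finite $\mathbb{U}\subset\mathbb{Z}^2$ is a map $\mathbb{U}\to V_G$ sending any two positions of $\mathbb{U}$ at $\ell^1$-distance $1$ to adjacent vertices of $G$. $\boldsymbol{B}^2(r)=\llbracket -r,r\rrbracket^2$. Box-extension property of $X=X^2_G$: there exists $r\ge 1$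 such that for all $n\ge 0$, every locally admissible pattern on $\boldsymbol{B}^2(n+r+1)\setminus\boldsymbol{B}^2(n+r)$ which can be extended into a locally admissible pattern on $\boldsymbol{B}^2(n+r+1)\setminus\boldsymbol{B}^2(n)$ can be extended into a configuration of $X$. *)

(* Defs.v *)
From HB Require Import structures.
From mathcomp Require Import all_boot all_order all_algebra.

Set Implicit Arguments.
Unset Strict Implicit.
Unset Printing Implicit Defensive.

Import Order.TTheory GRing.Theory Num.Theory.
Local Open Scope ring_scope.

(* Finite undirected graphs; self-loops are allowed. *)
Record ugraph := UGraph {
  vertex :> finType;
  adj : rel vertex;
  adj_sym : symmetric adj
}.

Definition Z2 : Type := int * int.

Definition dist1 (i j : Z2) : int := `|i.1 - j.1| + `|i.2 - j.2|.

Definition box (r : nat) : pred Z2 :=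
  fun i => (`|i.1| <= r%:Z) && (`|i.2| <= r%:Z).

Definition annulus (m n : nat) : pred Z2 := fun i => box m i && ~~ box n i.

Definition homshift (G : ugraph) (x : Z2 -> G) : Prop :=
  forall i j : Z2, dist1 i j = 1 -> adj (x i) (x j).

Definition pattern (G : ugraph) (U : pred Z2) : Type := {i : Z2 | U i} -> G.

Definition locally_admissible (G : ugraph) (U : pred Z2) (p : pattern G U) :
    Prop :=
  forall i j : {i : Z2 | U i}, dist1 (val i) (val j) = 1 -> adj (p i) (p j).

(* The existential over [W i] also forces U to be included in W. *)
Definition pattern_extends (G : ugraph) (U W : pred Z2)
    (p : pattern G U) (q : pattern G W) : Prop :=
  forall (i : Z2) (Ui : U i),
    exists Wi : W i, q (exist _ i Wi) = p (exist _ i Ui).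

Definition config_extends (G : ugraph) (U : pred Z2)
    (p : pattern G U) (x : Z2 -> G) : Prop :=
  forall i : {i : Z2 | U i}, x (val i) = p i.

Definition box_extension (G : ugraph) : Prop :=
  exists r : nat, (1 <= r)%N /\
  forall (n : nat) (p : pattern G (annulus (n + r + 1) (n + r))),
    locally_admissible p ->
    (exists q : pattern G (annulus (n + r + 1) n),
        locally_admissible q /\ pattern_extends p q) ->
    exists x : Z2 -> G, homshift x /\ config_extends p x.

Inductive kvertex : Type :=
  | omega
  | mu1 | mu2 | mu3 | mu4 | mu5 | mu6
  | gamma1 | gamma2 | gamma3
  | delta1 | delta2 | delta3
  | epsilon1 | epsilon2 | epsilon3.

Definition kvertices : seq kvertex :=
  [:: omega; mu1; mu2; mu3; mu4; mu5; mu6; gamma1; gamma2; gamma3;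
      delta1; delta2; delta3; epsilon1; epsilon2; epsilon3].

Definition kcode (v : kvertex) : nat :=
  match v with
  | omega => 0
  | mu1 => 1 | mu2 => 2 | mu3 => 3 | mu4 => 4 | mu5 => 5 | mu6 => 6
  | gamma1 => 7 | gamma2 => 8 | gamma3 => 9
  | delta1 => 10 | delta2 => 11 | delta3 => 12
  | epsilon1 => 13 | epsilon2 => 14 | epsilon3 => 15
  end.

Lemma kcodeK : cancel kcode (nth omega kvertices).
Proof. by case. Qed.

HB.instance Definition _ := Countable.copy kvertex (can_type kcodeK).

Lemma kvertices_enum : Finite.axiom kvertices.
Proof. by case. Qed.

HB.instance Definition _ := isFinite.Build kvertex kvertices_enum.

Definition kedges : seq (kvertex * kvertex) :=
  [:: (omega, mu1); (omega, mu2); (omega, mu3);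
      (omega, mu4); (omega, mu5); (omega, mu6);
      (gamma1, mu2); (gamma1, mu3); (gamma2, mu4);
      (gamma2, mu5); (gamma3, mu1); (gamma3, mu6);
      (delta1, mu1); (delta1, mu2); (delta2, mu3);
      (delta2, mu4); (delta3, mu5); (delta3, mu6);
      (epsilon1, delta1); (epsilon2, delta2); (epsilon3, delta3);
      (epsilon1, gamma1); (epsilon1, gamma3); (epsilon2, gamma1);
      (epsilon2, gamma2); (epsilon3, gamma2); (epsilon3, gamma3)].

Definition kadj : rel kvertex :=
  fun u v => ((u, v) \in kedges) || ((v, u) \in kedges).

Lemma kadj_sym : symmetric kadj.
Proof. by move=> u v; rewrite /kadj orbC. Qed.

Definition Kenkatabami : ugraph := UGraph kadj_sym.

(* Main.v *)
Require Import Defs.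
From mathcomp Require Import all_boot all_order all_algebra.
From mathcomp Require Import zify.

(* The graph is a disk tiled by quadrilaterals whose boundary is the 6-cycle
   [hexagon], and a word running around the hexagon at full speed is rigid.
   Prescribe on the boundary of a large box a word [hexagon (height i j)] that
   runs at full speed except on a segment of length [2 r] in the middle of the
   right (and left) side, where it hesitates; it extends [r] layers inwards.
   In a full extension the two right corners force their whole quadrants, so a
   horizontal strip of constant height [2 r] and arbitrary length has its top
   row running forwards and its bottom row running backwards.  By the pigeonhole
   principle two columns of the strip agree, and between them every row is
   periodic.  Leaving the hexagon loses a step with respect to the row above, so
   a periodic row below a full-speed row is again full-speed in the same
   direction: the top and bottom rows cannot disagree. *)

Set Implicit Arguments.
Unset Strict Implicit.

Import Order.TTheory GRing.Theory Num.Theory.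
Local Open Scope ring_scope.

(** * The boundary hexagon and its rigidity *)

Definition hexagon (t : int) : kvertex :=
  nth omega [:: gamma3; epsilon1; gamma1; epsilon2; gamma2; epsilon3]
    `|(t %% 6)%Z|%N.

Lemma hexagon_cases (P : int -> Prop) :
  (forall s t, (s = t %[mod 6])%Z -> P s -> P t) ->
  P 0 -> P 1 -> P 2 -> P 3 -> P 4 -> P 5 -> forall t, P t.
Proof.
move=> Pmod P0 P1 P2 P3 P4 P5 t; apply: (Pmod (t %% 6)%Z).
  by rewrite modz_mod.
have : (0 <= t %% 6 < 6)%Z by lia.
by case: (t %% 6)%Z => [[|[|[|[|[|[|?]]]]]]|?].
Qed.

Lemma hexagon_mod s t : (s = t %[mod 6])%Z -> hexagon s = hexagon t.
Proof. by rewrite /hexagon => ->. Qed.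

Lemma hexagon_modD s t d :
  (s = t %[mod 6])%Z -> hexagon (s + d) = hexagon (t + d).
Proof. by move=> st; apply: hexagon_mod; lia. Qed.

Lemma hexagon_inj s t : hexagon s = hexagon t -> (s = t %[mod 6])%Z.
Proof.
rewrite /hexagon.
have : (0 <= s %% 6 < 6)%Z by lia.
have : (0 <= t %% 6 < 6)%Z by lia.
by case: (s %% 6)%Z => [[|[|[|[|[|[|?]]]]]]|?] //;
   case: (t %% 6)%Z => [[|[|[|[|[|[|?]]]]]]|?].
Qed.

Lemma hexagon_adj t : kadj (hexagon t) (hexagon (t + 1)).
Proof.
move: t; apply: hexagon_cases => // s t st.
by rewrite (hexagon_mod st) (hexagon_modD 1 st).
Qed.

Lemma hexagon_adjN1 t : kadj (hexagon t) (hexagon (t - 1)).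
Proof. by rewrite kadj_sym -{2}(subrK 1 t) hexagon_adj. Qed.

(** Another common neighbour would close a 4-cycle through two consecutive hexagon edges, and the
    graph has none. All the forcing below rests on this. *)
Lemma hexagon_middle t y :
  kadj y (hexagon (t - 1)) -> kadj y (hexagon (t + 1)) -> y = hexagon t.
Proof.
move: t; apply: hexagon_cases => [s t st||||||].
  by rewrite (hexagon_mod st) !(hexagon_modD _ st).
all: by rewrite /hexagon /=; case: y.
Qed.

(* Odd positions are the epsilons, whose only neighbour off the hexagon is a
   delta; such a detour cannot be completed at full speed. *)
Lemma hexagon_no_detour t y0 y1 y2 : (t %% 2)%Z = 1 ->
  kadj y0 (hexagon t) -> kadj y1 (hexagon (t + 1)) ->
  kadj y2 (hexagon (t + 2)) -> kadj y0 y1 -> kadj y1 y2 ->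
  [|| y0 == hexagon (t + 1), y1 == hexagon (t + 2), y2 == hexagon (t + 3),
      y0 == hexagon (t - 1), y1 == hexagon t | y2 == hexagon (t + 1)].
Proof.
move: t; apply: hexagon_cases => [s t st IHs t1|//||//||//|].
  have s1 : (s %% 2)%Z = 1 by move: st t1; clear; lia.
  by rewrite -(hexagon_mod st) -!(hexagon_modD _ st); apply: IHs.
all: rewrite /hexagon /= => _.
all: by case: y0 => // _; case: y1 => // + + _; case: y2.
Qed.

(** * A periodic row next to a full-speed row *)

Section PeriodicRow.

Variables (P : nat) (a : int) (g : nat -> kvertex).
Hypothesis P_gt0 : (0 < P)%N.
Hypothesis below : forall k, (k <= P)%N -> kadj (g k) (hexagon (a + k%:Z)).
Hypothesis path : forall k, (k < P)%N -> kadj (g k) (g k.+1).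
Hypothesis g_periodic : g 0%N = g P.
Hypothesis hexagon_periodic : hexagon a = hexagon (a + P%:Z).

(** [g m] is a common neighbour of [hexagon (a + m)] and of [g m.+1], two steps further, hence
    forced: a lead spreads backwards. Symmetrically, a lag spreads forwards. *)
Lemma ahead_backward k : (k <= P)%N -> g k = hexagon (a + k%:Z + 1) ->
  forall m, (m <= k)%N -> g m = hexagon (a + m%:Z + 1).
Proof.
elim: k => [|k IHk] kP gk m mk; first by have ->: m = 0%N by lia.
have [->//|/eqP neq] := altP (m =P k.+1).
apply: IHk; [lia| |lia]; apply: hexagon_middle.
  by rewrite addrK below // ltnW.
by rewrite -[X in a + X](addrK 1) -PoszD addn1 addrA subrK -gk path.
Qed.

Lemma behind_forward k : (k <= P)%N -> g k = hexagon (a + k%:Z - 1) ->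
  forall m, (k + m <= P)%N -> g (k + m)%N = hexagon (a + (k + m)%:Z - 1).
Proof.
move=> kP gk; elim=> [|m IHm] kmP; first by rewrite addn0.
rewrite addnS in kmP *; apply: hexagon_middle; last by rewrite subrK below.
rewrite kadj_sym (_ : _ - 1 - 1 = a + (k + m)%:Z - 1); last by lia.
by rewrite -IHm ?path // ltnW.
Qed.

(** Among three consecutive entries one is a step ahead or behind. This spreads to one end of the
    row, periodicity carries it to the other end, and from there it spreads over the whole row. *)
Lemma periodic_row : exists b, forall k, (k <= P)%N -> g k = hexagon (b + k%:Z).
Proof.
have aP := hexagon_inj hexagon_periodic.
have ahead k : (k <= P)%N -> g k = hexagon (a + k%:Z + 1) ->
    exists b, forall m, (m <= P)%N -> g m = hexagon (b + m%:Z).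
  move=> kP /(ahead_backward kP) /(_ 0%N isT); rewrite g_periodic => gP.
  exists (a + 1) => m mP; rewrite addrAC; apply: ahead_backward mP => //.
  by rewrite gP; apply: hexagon_mod; lia.
have behind k : (k <= P)%N -> g k = hexagon (a + k%:Z - 1) ->
    exists b, forall m, (m <= P)%N -> g m = hexagon (b + m%:Z).
  move=> kP /(behind_forward kP) /(_ (P - k)%N).
  rewrite subnKC // -g_periodic => gP.
  exists (a - 1) => m mP; rewrite addrAC.
  apply: (@behind_forward 0%N) mP => //.
  by rewrite gP //; apply: hexagon_mod; lia.
(* [P] is a positive multiple of 6, so the entries [k], [k + 1], [k + 2] with [k <= 1] exist. *)
have P3 : (3 <= P)%N by lia.
have [k k1 odd_k] : exists2 k : nat, (k <= 1)%N & ((a + k%:Z) %% 2)%Z = 1.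
  by have [|] := eqVneq ((a + 0) %% 2)%Z 1; [exists 0%N | exists 1%N => //; lia].
have := @hexagon_no_detour _ (g k) (g k.+1) (g k.+2) odd_k.
have eD d : a + k%:Z + d%:Z = a + (k + d)%:Z by lia.
rewrite (eD 1%N) (eD 2%N) addn1 addn2 !below ?path; try lia.
move=> /(_ isT isT isT isT isT).
case/or4P => [/eqP e|/eqP e|/eqP e|/or3P[] /eqP e].
- by apply: (ahead k); [lia | rewrite e; congr hexagon; lia].
- by apply: (ahead k.+1); [lia | rewrite e; congr hexagon; lia].
- by apply: (ahead k.+2); [lia | rewrite e; congr hexagon; lia].
- by apply: (behind k); [lia | rewrite e; congr hexagon; lia].
- by apply: (behind k.+1); [lia | rewrite e; congr hexagon; lia].
- by apply: (behind k.+2); [lia | rewrite e; congr hexagon; lia].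
Qed.

End PeriodicRow.

(** * Forcing from a corner *)

Lemma corner_forced (f : nat -> nat -> kvertex) (M : nat) (t : int) :
    (forall a b, (a < M)%N -> (b <= M)%N -> kadj (f a b) (f a.+1 b)) ->
    (forall a b, (a <= M)%N -> (b < M)%N -> kadj (f a b) (f a b.+1)) ->
    (forall a, (a <= M)%N -> f a 0%N = hexagon (t - a%:Z)) ->
    (forall b, (b <= M)%N -> f 0%N b = hexagon (t + b%:Z)) ->
  forall a b, (a <= M)%N -> (b <= M)%N -> f a b = hexagon (t - a%:Z + b%:Z).
Proof.
move=> fa fb f0 f0b a b; elim: b a => [|b IHb] a aM bM.
  by rewrite f0 // addr0.
elim: a aM => [|a IHa] aM; first by rewrite f0b // subr0.
(* The known neighbours [f a.+1 b] and [f a b.+1] are two steps apart on the hexagon. *)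
apply: hexagon_middle.
  rewrite (_ : _ - 1 = t - a.+1%:Z + b%:Z); last by clear; lia.
  by rewrite -IHb ?(ltnW bM) // kadj_sym fb.
rewrite (_ : _ + 1 = t - a%:Z + b.+1%:Z); last by clear; lia.
by rewrite -IHa ?(ltnW aM) // kadj_sym fa.
Qed.

(** * Heights of the prescribed word *)

Section Height.

Variables N r : nat.

Definition top_height (i j : int) : int := `|i| - j + N%:Z.

(** At [|i| = N], [j = - r] this is [2 * N - r], the value of [top_height] at [|i| = N], [j = r]:
    the word resumes at the level where it began to hesitate. *)
Definition bottom_height (i j : int) : int :=
  3 * N%:Z - 2 * r%:Z - `|i| - j.

(* The remainder modulo 2 gives all three heights the same parity. *)
Definition middle_height (i j : int) : int :=
  2 * N%:Z - r%:Z + ((`|i| - j - N%:Z + r%:Z) %% 2)%Z.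

Definition height (i j : int) : int :=
  if r%:Z <= j then top_height i j
  else if j <= - r%:Z then bottom_height i j
  else Num.max (bottom_height i j)
         (Num.min (top_height i j) (middle_height i j)).

Lemma max_step (a b a' b' : int) : (a = b %[mod 2])%Z ->
  `|a - a'| = 1 -> `|b - b'| = 1 -> `|Num.max a b - Num.max a' b'| = 1.
Proof. lia. Qed.

Lemma min_step (a b a' b' : int) : (a = b %[mod 2])%Z ->
  `|a - a'| = 1 -> `|b - b'| = 1 -> `|Num.min a b - Num.min a' b'| = 1.
Proof. lia. Qed.

Lemma top_step i j : dist1 i j = 1 ->
  `|top_height i.1 i.2 - top_height j.1 j.2| = 1.
Proof. rewrite /dist1 /top_height; lia. Qed.

Lemma bottom_step i j : dist1 i j = 1 ->
  `|bottom_height i.1 i.2 - bottom_height j.1 j.2| = 1.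
Proof. rewrite /dist1 /bottom_height; lia. Qed.

Lemma middle_step i j : dist1 i j = 1 ->
  `|middle_height i.1 i.2 - middle_height j.1 j.2| = 1.
Proof.
move=> /top_step; rewrite /top_height /middle_height.
move: `|i.1| `|j.1| => u v; lia.
Qed.

Lemma height_top i j : r%:Z <= j -> height i j = top_height i j.
Proof. by rewrite /height => ->. Qed.

Lemma height_bottom i j : (0 < r)%N -> j <= - r%:Z ->
  height i j = bottom_height i j.
Proof. by move=> r0 jr; rewrite /height jr ifN //; lia. Qed.

(** [bottom_height i j <= top_height i j] exactly when [N - r <= |i|]: this is why hesitating over a
    length [2 r] allows an extension [r] layers deep. *)
Lemma height_side i j : N%:Z - r%:Z <= `|i| <= N%:Z ->
  height i j = Num.max (bottom_height i j)
                 (Num.min (top_height i j) (middle_height i j)).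
Proof.
rewrite /height /top_height /bottom_height /middle_height.
move: `|i| => u Nru.
case: ifPn => [|_]; first by lia.
case: ifPn => [|//]; lia.
Qed.

Lemma height_step i j : (0 < r)%N -> dist1 i j = 1 ->
    `|i.1| <= N%:Z -> (`|i.2| < r%:Z -> N%:Z - r%:Z <= `|i.1|) ->
    `|j.1| <= N%:Z -> (`|j.2| < r%:Z -> N%:Z - r%:Z <= `|j.1|) ->
  `|height i.1 i.2 - height j.1 j.2| = 1.
Proof.
move=> r0 ij iN hi jN hj.
have [[iNr jNr]|far] :
    (N%:Z - r%:Z <= `|i.1| /\ N%:Z - r%:Z <= `|j.1|) \/
    ((r%:Z <= i.2 /\ r%:Z <= j.2) \/ (i.2 <= - r%:Z /\ j.2 <= - r%:Z)).
  by move: ij hi hj; rewrite /dist1; lia.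
  rewrite !height_side ?iNr ?jNr //; apply: max_step; last apply: min_step.
  - by rewrite /bottom_height /top_height /middle_height; lia.
  - exact: bottom_step.
  - by rewrite /bottom_height /top_height /middle_height; lia.
  - exact: top_step.
  - exact: middle_step.
case: far => [[ir jr]|[ir jr]].
  by rewrite !height_top ?top_step.
by rewrite !height_bottom ?bottom_step.
Qed.

End Height.

Lemma hexagon_step s t : `|s - t| = 1 -> kadj (hexagon s) (hexagon t).
Proof.
move=> st; have [->|->] : t = s + 1 \/ t = s - 1 by lia.
  exact: hexagon_adj.
exact: hexagon_adjN1.
Qed.

(** * Two rows running in opposite directions *)

Lemma opposite_rows_false (H M : nat) (f : nat -> nat -> kvertex) (a b : int) :
    (#|{: {ffun 'I_H.+1 -> kvertex}}| <= M)%N ->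
    (forall k m, (k < M)%N -> (m <= H)%N -> kadj (f k m) (f k.+1 m)) ->
    (forall k m, (k <= M)%N -> (m < H)%N -> kadj (f k m) (f k m.+1)) ->
    (forall k, (k <= M)%N -> f k 0%N = hexagon (a + k%:Z)) ->
    (forall k, (k <= M)%N -> f k H = hexagon (b - k%:Z)) ->
  False.
Proof.
move=> cardM fk fm f0 fH.
pose column (k : 'I_M.+1) := [ffun m : 'I_H.+1 => f k m].
have /injectivePn[k1 [k2 k12 ek]] : ~~ injectiveb column.
  apply/negP => /injectiveP /leq_card; rewrite card_ord.
  by move=> /leq_trans /(_ cardM); rewrite ltnn.
have {k12 ek} [k [P [P0 kPM eqk]]] : exists k P : nat, [/\ (0 < P)%N,
    (k + P <= M)%N & forall m, (m <= H)%N -> f k m = f (k + P)%N m].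
  have colE m : (m <= H)%N -> f k1 m = f k2 m.
    rewrite -ltnS => mH.
    have := congr1 (fun g : {ffun _} => g (Ordinal mH)) ek.
    by rewrite !ffunE.
  have [lt12|lt21|/val_inj eq12] := ltngtP k1 k2; last first.
  - by rewrite eq12 eqxx in k12.
  - exists k2, (k1 - k2)%N; rewrite (subnKC (ltnW lt21)).
    by split=> [||m /colE]; rewrite ?subn_gt0 // -ltnS.
  - exists k1, (k2 - k1)%N; rewrite (subnKC (ltnW lt12)).
    by split; rewrite ?subn_gt0 // -ltnS.
have kM j : (j <= P)%N -> (k + j <= M)%N.
  by move=> jP; apply: leq_trans kPM; rewrite leq_add2l.
have row m : (m <= H)%N ->
    exists c, forall j, (j <= P)%N -> f (k + j)%N m = hexagon (c + j%:Z).
  elim: m => [|m IHm] mH.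
    by exists (a + k%:Z) => j jP; rewrite f0 ?kM // PoszD addrA.
  have [c cE] := IHm (ltnW mH).
  apply: (@periodic_row P c (fun j => f (k + j)%N m.+1)) => // [j jP|j jP||].
  - by rewrite -cE // kadj_sym fm // kM.
  - by rewrite addnS fk // -addnS kM.
  - by rewrite addn0 eqk.
  - by rewrite -[X in hexagon X]addr0 -!cE // addn0 eqk // ltnW.
(* Row [H] would advance and retreat at once: the first two entries give 2 = 0 modulo 6. *)
have [c cE] := row H (leqnn H).
have := cE 0%N isT; have := cE 1%N P0.
rewrite !fH ?kM // => /hexagon_inj e1 /hexagon_inj e0.
move: e0 e1; clear; lia.
Qed.

(** * The boundary word that does not extend *)

Theorem corollary7p6 : ~ box_extension Kenkatabami.
Proof.
(* The cardinal makes the strip long enough for the pigeonhole principle. The summand [r] gives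
   [r <= n], so a point of the annulus with [|j| < r] has [|i| > n], that is [|i| >= N - r]. *)
case=> r [r0 /(_ (r + #|{: {ffun 'I_(2 * r).+1 -> kvertex}}|)%N)].
move nE: (r + _)%N => n; have rn : (r <= n)%N by rewrite -nE leq_addr.
set N := (n + r + 1)%N => ext.
pose q U : pattern Kenkatabami U :=
  fun i => hexagon (height N r (val i).1 (val i).2).
have q_admissible (U : pred Z2) : (forall i, U i -> annulus N n i) ->
    locally_admissible (q U).
  move=> UN [i Ui] [j Uj] /= ij; move: (UN i Ui) (UN j Uj) => iN jN.
  apply: hexagon_step; apply: height_step => //; move: rn iN jN;
    rewrite /annulus /box /N /=; clear; lia.
have [||x [x_hom xq]] := ext (q _).
- apply: q_admissible => i; rewrite /annulus /box /N /=; clear; lia.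
- exists (q _); split; first exact: q_admissible.
  move=> i Ui; suff Wi : annulus N n i by exists Wi.
  by move: Ui; rewrite /annulus /box /N /=; clear; lia.
have {}xq i j : `|i| <= N%:Z -> `|j| <= N%:Z -> N%:Z <= `|i| \/ N%:Z <= `|j| ->
    x (i, j) = hexagon (height N r i j).
  move=> iN jN ij; have Uij : annulus N (n + r) (i, j).
    by move: iN jN ij; rewrite /annulus /box /N /=; clear; lia.
  exact: (xq (exist _ (i, j) Uij)).
have xh i j i' j' : `|i - i'| + `|j - j'| = 1 -> kadj (x (i, j)) (x (i', j')).
  exact: (x_hom (i, j) (i', j')).
(* The forced square at the corner [(N, N)] has side [n + 1], so it reaches down to row [r]. *)
have top a b : (a <= n.+1)%N -> (b <= n.+1)%N ->
    x (N%:Z - a%:Z, N%:Z - b%:Z) = hexagon (N%:Z - a%:Z + b%:Z).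
  apply: (@corner_forced (fun a b => x (N%:Z - a%:Z, N%:Z - b%:Z))).
  - by move=> *; apply: xh; clear; lia.
  - by move=> *; apply: xh; clear; lia.
  - move=> {}a an; rewrite xq ?height_top /top_height; first congr hexagon;
      move: an; rewrite /N; clear; lia.
  - move=> {}b bn; rewrite xq ?height_top /top_height; first congr hexagon;
      move: bn; rewrite /N; clear; lia.
(* From the corner [(N, - N)] the height falls upwards and rises leftwards, so [a] is now the
   vertical coordinate; the square reaches up to row [- r]. *)
have bottom a b : (a <= n.+1)%N -> (b <= n.+1)%N ->
    x (N%:Z - b%:Z, - (N%:Z - a%:Z)) =
    hexagon (3 * N%:Z - 2 * r%:Z - a%:Z + b%:Z).
  apply: (@corner_forced (fun a b => x (N%:Z - b%:Z, - (N%:Z - a%:Z)))).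
  - by move=> *; apply: xh; clear; lia.
  - by move=> *; apply: xh; clear; lia.
  - move=> {}a an; rewrite xq ?height_bottom /bottom_height //;
      first congr hexagon; move: an; rewrite /N; clear; lia.
  - move=> {}b bn; rewrite xq ?height_bottom /bottom_height //;
      first congr hexagon; move: bn; rewrite /N; clear; lia.
apply: (@opposite_rows_false (2 * r) n.+1
  (fun k m => x (r%:Z + k%:Z, r%:Z - m%:Z)) N%:Z (3 * N%:Z - 2 * r%:Z)).
- by rewrite -nE -addnS; apply: leq_trans (leq_addl r _); rewrite leqnSn.
- by move=> *; apply: xh; clear; lia.
- by move=> *; apply: xh; clear; lia.
- move=> k kn; have := top (n.+1 - k)%N n.+1 (leq_subr _ _) (leqnn _).
  have -> : (N%:Z - (n.+1 - k)%:Z, N%:Z - n.+1%:Z) = (r%:Z + k%:Z, r%:Z - 0%:Z).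
    by move: kn; rewrite /N; clear => ?; congr pair; lia.
  by move=> ->; congr hexagon; move: kn; rewrite /N; clear; lia.
- move=> k kn; have := bottom n.+1 (n.+1 - k)%N (leqnn _) (leq_subr _ _).
  have -> : (N%:Z - (n.+1 - k)%:Z, - (N%:Z - n.+1%:Z)) =
            (r%:Z + k%:Z, r%:Z - (2 * r)%:Z).
    by move: kn; rewrite /N; clear => ?; congr pair; lia.
  by move=> ->; congr hexagon; move: kn; rewrite /N; clear; lia.
Qed.
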